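(* Let $R$ be a Dedekind domain with fraction field $K$, let $R[x]=R[x_1,\dots,x_n]$ be equipped with a monomial ordering $<$, and let $(f,\mathfrak f)$, $(g,\mathfrak g)$ be non-zero pseudo-polynomials of $R[x]$ such that $\operatorname{lm}(f)$ and $\operatorname{lm}(g)$ are coprime in $K[x]$ and such that $\operatorname{lc}(f,\mathfrak f)$ and $\operatorname{lc}(g,\mathfrak g)$ are coprime ideals of $R$. Then the S-polynomial $\operatorname{spoly}((f,\mathfrak f),(g,\mathfrak g))$ reduces to $0$ modulo $\{(f,\mathfrak f),(g,\mathfrak g)\}$.
   Context: A Dedekind domain is a Noetherian integrally closed domain of Krull dimension one. A monomial ordering is a total well-ordering on monomials compatible with multiplication. For non-zero $f=\sum_\alpha c_\alpha x^\alpha\in K[x]$, $\deg(f)\in\mathbb N^n$ is the largest exponent $\alpha$ (with respect to $<$) with $c_\alpha\ne0$; $\operatorname{lm}(f)=x^{\deg(f)}$, $\operatorname{lc}(f)=c_{\deg(f)}$. A fractional ideal of $R$ is a non-zero finitely generated $R$-submodule of $K$. A pseudo-polynomial of $R[x]$ is a pair $(f,\mathfrak f)$ with $f\in K[x]$ and $\mathfrak f$ a fractional ideal of $R$ such that $\mathfrak f f\subseteq R[x]$; it is zero if $f=0$. Its leading coefficient is the integral ideal $\operatorname{lc}(f,\mathfrak f)=\mathfrak f\operatorname{lc}(f)\subseteq R$. Reduction: let $(p,\mathfrak p)$ and $G=\{(g_i,\mathfrak g_i)\}$ be non-zero pseudo-polynomials and $J=\{i\mid \operatorname{lm}(g_i)\text{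 divides }\operatorname{lm}(p)\}$. $(p,\mathfrak p)$ can be reduced modulo $G$ if $\operatorname{lc}(p,\mathfrak p)\subseteq\sum_{i\in J}\operatorname{lc}(g_i,\mathfrak g_i)$; equivalently, there exist $a_i\in\mathfrak g_i\mathfrak p^{-1}$, $i\in J$, with $\operatorname{lc}(p)=\sum_{i\in J}a_i\operatorname{lc}(g_i)$. For any such choice, $(p-\sum_{i\in J}a_ix^{\deg(p)-\deg(g_i)}g_i,\ \mathfrak p)$ is called a one step reduction of $(p,\mathfrak p)$ with respect to $G$. $(p,\mathfrak p)$ reduces to $(h,\mathfrak p)$ modulo $G$ if $(h,\mathfrak p)$ is obtained from $(p,\mathfrak p)$ by a finite (possibly empty) chain of one step reductions; ''reduces to $0$'' means reduces to $(0,\mathfrak p)$. S-polynomial: for non-zero pseudo-polynomials $(f,\mathfrak f)$, $(g,\mathfrak g)$ and $m=\operatorname{lcm}(\operatorname{lm}(f),\operatorname{lm}(g))$, $$\operatorname{spoly}((f,\mathfrak f),(g,\mathfrak g))=\Bigl(\tfrac{m}{\operatorname{lm}(f)}\tfrac1{\operatorname{lc}(f)}f-\tfrac{m}{\operatorname{lm}(g)}\tfrac1{\operatorname{lc}(g)}g,\ \operatorname{lc}(f)\mathfrak f\cap\operatorname{lc}(g)\mathfrak g\Bigr).$$ *)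

(* Defs.v *)
From mathcomp Require Import all_boot all_order all_algebra.
From mathcomp Require Import classical_sets wochoice.
From mathcomp Require Import mpoly.
From Stdlib Require Import Relations.Relation_Operators.

Set Implicit Arguments.
Unset Strict Implicit.
Unset Printing Implicit Defensive.

Import GRing.Theory.

Local Open Scope classical_set_scope.
Local Open Scope ring_scope.

Local Notation "x %:F" := (tofrac x).

Section DedekindDomain.

Variable R : idomainType.

(* Ideals are Prop-valued sets, and the unit ideal counts as an ideal (unlike
   with idealr_closed of ring_quotient.v). *)
Definition is_ideal (I : set R) : Prop :=
  [/\ I 0, (forall x y, I x -> I y -> I (x + y))
    & (forall a x, I x -> I (a * x))].

Definition is_prime_ideal (I : set R) : Prop :=
  [/\ is_ideal I, ~ I 1 & (forall a b, I (a * b) -> I a \/ I b)].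

Definition noetherian : Prop :=
  forall I : set R, is_ideal I ->
  exists m (e : 'I_m -> R), I = [set \sum_(i < m) c i * e i | c in setT].

Definition integrally_closed : Prop :=
  forall z : {fraction R}, integralOver (@tofrac R) z -> exists r, z = r%:F.

(* Only P 0, ..., P d matter: they form a chain of d strict inclusions. *)
Definition prime_chain (d : nat) (P : nat -> set R) : Prop :=
  (forall i, (i <= d)%N -> is_prime_ideal (P i)) /\
  (forall i, (i < d)%N -> P i `<` P i.+1).

Definition has_krull_dim (d : nat) : Prop :=
  (exists P, prime_chain d P) /\
  (forall e P, prime_chain e P -> (e <= d)%N).

Definition dedekind_domain : Prop :=
  [/\ noetherian, integrally_closed & has_krull_dim 1].

Definition coprime_ideals (I J : set R) : Prop :=
  [set x + y | x in I & y in J] = setT.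

End DedekindDomain.

Section FractionalIdeals.

Variable R : idomainType.
Local Notation K := {fraction R}.

Definition is_fractional_ideal (I : set K) : Prop :=
  (exists2 x, I x & x != 0) /\
  (exists m (e : 'I_m -> K),
     I = [set \sum_(i < m) (c i)%:F * e i | c in (setT : set ('I_m -> R))]).

Definition scale_ideal (a : K) (I : set K) : set K := [set a * x | x in I].

Definition mul_ideal (I J : set K) : set K :=
  [set z | exists m (x y : 'I_m -> K),
     [/\ (forall i, I (x i)), (forall i, J (y i))
       & z = \sum_(i < m) x i * y i]].

Definition inv_ideal (I : set K) : set K :=
  [set z | forall x, I x -> exists r, z * x = r%:F].

End FractionalIdeals.

(* The exponent a stands for the monomial 'X_[a], so that multiplication of
   monomials is addition of exponents. *)
Definition monomial_ordering n (le : rel 'X_{1..n}) : Prop :=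
  [/\ total_order le, well_order le
    & (forall a b c, le a b -> le (a + c)%MM (b + c)%MM)].

Section PseudoPolynomials.

Variables (n : nat) (R : idomainType) (le : rel 'X_{1..n}).
Local Notation K := {fraction R}.

(* The exponent of the leading monomial; the junk value for f = 0 is 0%MM. *)
Definition ldeg (f : {mpoly K[n]}) : 'X_{1..n} :=
  last 0%MM (sort le (msupp f)).

Definition lm (f : {mpoly K[n]}) : {mpoly K[n]} := 'X_[ldeg f].

Definition lc (f : {mpoly K[n]}) : K := f@_(ldeg f).

(* Coprimality in the ring K[x]: the common divisors are units (this is not
   comaximality). *)
Definition coprime_mpoly (p q : {mpoly K[n]}) : Prop :=
  forall d : {mpoly K[n]},
    (exists u, p = u * d) -> (exists v, q = v * d) -> d \is a GRing.unit.

(* The raw pairs, on which is_ppoly singles out the pseudo-polynomials. *)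
Definition ppoly : Type := ({mpoly K[n]} * set K)%type.

Definition is_ppoly (p : ppoly) : Prop :=
  is_fractional_ideal p.2 /\
  (forall c, p.2 c ->
     exists h : {mpoly R[n]}, c *: p.1 = map_mpoly (@tofrac R) h).

Definition nonzero_ppoly (p : ppoly) : Prop := is_ppoly p /\ p.1 != 0.

Definition lc_ideal (p : ppoly) : set R :=
  [set r | scale_ideal (lc p.1) p.2 r%:F].

(* The summation condition selects the index set J: divisibility of monomials
   is the pointwise order on exponents. *)
Definition one_step_reduction k (G : k.-tuple ppoly) (p q : ppoly) : Prop :=
  [/\ nonzero_ppoly p, (forall i, nonzero_ppoly (tnth G i))
    & exists a : 'I_k -> K,
      let J i := (ldeg (tnth G i).1 <= ldeg p.1)%MM in
      [/\ (forall i, J i -> mul_ideal (tnth G i).2 (inv_ideal p.2) (a i)),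
          lc p.1 = \sum_(i < k | J i) a i * lc (tnth G i).1
        & q = (p.1 - \sum_(i < k | J i)
                 a i *: ('X_[(ldeg p.1 - ldeg (tnth G i).1)%MM]
                           * (tnth G i).1),
               p.2)]].

Definition reduces_to k (G : k.-tuple ppoly) : ppoly -> ppoly -> Prop :=
  clos_refl_trans ppoly (one_step_reduction G).

Definition reduces_to_zero k (G : k.-tuple ppoly) (p : ppoly) : Prop :=
  reduces_to G p (0, p.2).

(* For exponents, m / lm(f) is the difference with the lcm. *)
Definition spoly (p q : ppoly) : ppoly :=
  let m := mlcm (ldeg p.1) (ldeg q.1) in
  ((lc p.1)^-1 *: ('X_[(m - ldeg p.1)%MM] * p.1)
     - (lc q.1)^-1 *: ('X_[(m - ldeg q.1)%MM] * q.1),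
   scale_ideal (lc p.1) p.2 `&` scale_ideal (lc q.1) q.2).

End PseudoPolynomials.

(* Main.v *)
(* After dividing f and g by their leading coefficients, f = x^a + ..., and
   g = x^b + ..., the attached ideals become comaximal ideals A and B of R, and
   the S-polynomial is u g + w f with u = f - x^a and w = x^b - g.  Keep this
   shape, with the exponents of u below a and those of w below b: as a and b
   have disjoint supports, the leading terms of u g and w f cannot cancel, and a
   reduction by g (or f) removes the leading term of u (or w).  Such a step is
   allowed because the coefficients c of u satisfy c A <= R, so that c lies in
   B (A B)^-1; this is where the invertibility of B is used. *)
Require Import Defs.
From mathcomp Require Import all_boot all_order all_algebra.
From mathcomp Require Import classical_sets wochoice.
From mathcomp Require Import mpoly.
From mathcomp Require Import boolp.
From mathcomp Require Import ring.
From Stdlib Require Import Relations.Relation_Operators.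

Set Implicit Arguments.
Unset Strict Implicit.
Unset Printing Implicit Defensive.

Import GRing.Theory.

Local Open Scope classical_set_scope.
Local Open Scope ring_scope.

Local Notation "x %:F" := (tofrac x).

(** * Invertibility of non-zero ideals of a Dedekind domain *)

Section Invertibility.

Variable R : idomainType.
Local Notation K := {fraction R}.
Implicit Types I J : set R.

Definition in_base (z : K) : Prop := exists r, z = r%:F.

Lemma in_baseD z t : in_base z -> in_base t -> in_base (z + t).
Proof. by move=> [r ->] [s ->]; exists (r + s); rewrite rmorphD. Qed.

Lemma in_baseM z t : in_base z -> in_base t -> in_base (z * t).
Proof. by move=> [r ->] [s ->]; exists (r * s); rewrite rmorphM. Qed.

Lemma in_base0 : in_base 0. Proof. by exists 0; rewrite rmorph0. Qed.

Lemma tofrac_inj : injective (@tofrac R).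
Proof. by move=> a b /eqP; rewrite tofrac_eq => /eqP. Qed.

Lemma is_ideal_sum I m (x : 'I_m -> R) :
  is_ideal I -> (forall i, I (x i)) -> I (\sum_i x i).
Proof. by case=> I0 ID _ hx; apply: big_ind. Qed.

Lemma span_gen m (e : 'I_m -> R) I i :
  I = [set \sum_(j < m) c j * e j | c in setT] -> I (e i).
Proof.
move=> ->; exists (fun j => (j == i)%:R) => //.
rewrite (bigD1 i) //= eqxx mul1r big1 ?addr0 // => j /negPf ->.
by rewrite mul0r.
Qed.

(** Without a maximal element, choice gives a strictly increasing chain in [S]. Its union is an
    ideal, hence finitely generated, and all the generators already lie in one member of the chain,
    which then cannot grow. *)
Lemma noetherian_max (S : set (set R)) : noetherian R ->
  S `<=` @is_ideal R -> S !=set0 ->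
  exists2 M, S M & forall I, S I -> M `<=` I -> I `<=` M.
Proof.
move=> hN Sid [I0 SI0]; apply: contrapT => nomax.
have /choice[nxt hnxt] : forall s : {I | S I},
    exists t : {I | S I}, sval s `<=` sval t /\ ~ (sval t `<=` sval s).
  move=> [M SM]; apply: contrapT => hM; apply: nomax; exists M => // I SI MI.
  by apply: contrapT => nIM; apply: hM; exists (exist _ I SI).
pose u k := sval (iter k nxt (exist _ I0 SI0)).
have u_id k : is_ideal (u k) by apply: Sid; rewrite /u; case: (iter _ _ _).
have uS k : u k `<=` u k.+1 by case: (hnxt (iter k nxt (exist _ I0 SI0))).
have u_mono k l : (k <= l)%N -> u k `<=` u l.
  move=> /subnK <-; elim: (l - k)%N => [//|d IH] x ukx.
  exact/uS/IH.
pose U : set R := fun x => exists k, u k x.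
have Uid : is_ideal U.
  split.
  - by exists 0%N; case: (u_id 0%N).
  - move=> x y [k ux] [l uy]; exists (maxn k l).
    have [_ uD _] := u_id (maxn k l).
    apply: uD; first by apply: u_mono ux; apply: leq_maxl.
    by apply: u_mono uy; apply: leq_maxr.
  - by move=> a x [k ux]; exists k; have [_ _ uM] := u_id k; apply: uM.
have [m [e Ue]] := hN _ Uid.
have /choice[d hd] : forall i, exists k, u k (e i).
  by move=> i; apply: (span_gen i Ue).
pose N := \max_i d i.
have UN : U `<=` u N.
  rewrite Ue => _ [c _ <-]; apply: is_ideal_sum => // i.
  have [_ _ uM] := u_id N; apply: uM; apply: u_mono (hd i).
  exact: (leq_bigmax i).
have [_] := hnxt (iter N nxt (exist _ I0 SI0)); apply.
by move=> x hx; apply: UN; exists N.+1.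
Qed.

(** A maximal element [M] of the proper ideals containing [I] is prime: if [a * b] is in [M] but [a]
    is not, then [1 = y + c * a] with [y] in [M], and multiplying by [b] puts [b] in [M]. *)
Lemma exists_prime_ideal I : noetherian R -> is_ideal I -> ~ I 1 ->
  exists2 P, I `<=` P & is_prime_ideal P.
Proof.
move=> hN idI I1.
pose S := [set J : set R | [/\ is_ideal J, I `<=` J & ~ J 1]].
have [| |M [idM IM M1] maxM] := noetherian_max (S := S) hN.
- by move=> J [].
- by exists I; split.
exists M => //; split=> // a b Mab; apply: contrapT => /not_orP[nMa nMb].
have [M0 MD MM] := idM.
pose J := [set x | exists2 y, M y & exists c, x = y + c * a].
have idJ : is_ideal J.
  split.
  - by exists 0 => //; exists 0; rewrite mul0r addr0.
  - move=> _ _ [y My [c ->]] [z Mz [d ->]].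
    by exists (y + z); [apply: MD|exists (c + d); rewrite mulrDl addrACA].
  - move=> r _ [y My [c ->]].
    by exists (r * y); [apply: MM|exists (r * c); rewrite mulrDr mulrA].
have MJ : M `<=` J.
  by move=> y My; exists y => //; exists 0; rewrite mul0r addr0.
have [[y My [c E]]|J1] := pselect (J 1); last first.
  apply: nMa; apply: (maxM J) => //; first by split=> // x /IM /MJ.
  by exists 0 => //; exists 1; rewrite mul1r add0r.
apply: nMb; rewrite -[b]mul1r E mulrDl; apply: MD.
  by rewrite mulrC; apply: MM.
by rewrite -mulrA; apply: MM.
Qed.

(* Let P be a prime containing I. A maximal ideal among the (a : b) contained
   in P is prime; by dimension one it is P, and b / a is then in the inverse of
   P but not in R. *)
Lemma proper_inv_gt I : dedekind_domain R -> is_ideal I -> ~ I 1 ->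
  (exists2 a, I a & a != 0) ->
  exists2 x : K, ~ in_base x & forall r, I r -> in_base (x * r%:F).
Proof.
move=> [hN _ [_ hdim]] idI I1 [a Ia a0].
have [P IP prP] := exists_prime_ideal hN idI I1.
have [idP P1 PM] := prP.
have [P0 PD PZ] := idP.
pose Q b : set R := [set x | exists y, x * b = y * a].
have idQ b : is_ideal (Q b).
  split.
  - by exists 0; rewrite !mul0r.
  - by move=> x y [s E] [t E']; exists (s + t); rewrite !mulrDl E E'.
  - by move=> r x [s E]; exists (r * s); rewrite -!mulrA E.
have Qa b : Q b a by exists b; rewrite mulrC.
pose S := [set J : set R | J `<=` P /\ exists b, J = Q b].
have [| |Qb [QP [b Eb]] maxQ] := noetherian_max (S := S) hN.
- by move=> _ [_ [b ->]].
- exists (Q 1); split; last by exists 1.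
  move=> x [y]; rewrite mulr1 => ->; apply: PZ; exact: IP.
subst Qb.
(* For [y] outside the prime [P], the colon ideal [Q (b * y)] contains [Q b] and still lies in [P],
   so by maximality the two are equal. *)
have QbM y : ~ P y -> forall x, Q b (x * y) -> Q b x.
  move=> Py x [s E].
  have sQ : Q b `<=` Q (b * y).
    by move=> z [t F]; exists (t * y); rewrite mulrA F mulrAC.
  apply: (maxQ (Q (b * y))) => //; last first.
    by exists s; ring: E.
  split; last by exists (b * y).
  move=> t [r F]; have /QP : Q b (t * y) by exists r; ring: F.
  by case/PM.
have prQ : is_prime_ideal (Q b).
  split=> //; first by move/QP.
  move=> x y Qxy; have [Px|Px] := pselect (P x); last first.
    by right; apply: (QbM x) => //; rewrite mulrC.
  have [?|nQx] := pselect (Q b x); [by left|right].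
  have sQ : Q b `<=` Q (b * x).
    by move=> z [t F]; exists (t * x); rewrite mulrA F mulrAC.
  apply: (maxQ (Q (b * x))) => //; last first.
    by case: Qxy => s F; exists s; rewrite -F; rewrite mulrA mulrAC (mulrC y).
  split; last by exists (b * x).
  move=> s [r F]; apply: contrapT => Ps; apply: nQx.
  by apply: (QbM s) => //; exists r; ring: F.
have PQ : P `<=` Q b.
  apply: contrapT => nPQ.
  (* Otherwise [0], [Q b], [P] would be a chain of primes with two strict inclusions, the first
     being strict because [a] is in [Q b]. *)
  pose c k : set R :=
    if k is k'.+1 then if k' is 0 then Q b else P else [set 0].
  suff /hdim : prime_chain 2 c by [].
  split.
  - move=> [|[|k]] _ //=; split.
    + split=> //= [x y -> ->|r x ->]; [exact: addr0|exact: mulr0].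
    + by move=> /= /eqP; rewrite oner_eq0.
    + by move=> x y /= /eqP; rewrite mulf_eq0 => /orP[]/eqP; [left|right].
  - move=> [|[|//]] _ /=; split=> //; first by move=> x ->; case: (idQ b).
    by move=> /(_ _ (Qa b)) /= a00; rewrite a00 eqxx in a0.
have aF : a%:F != 0 :> K by rewrite tofrac_eq0.
(* If [b / a] were in [R], then [1] would be in [Q b], hence in [P]. *)
exists (b%:F / a%:F).
  move=> [r E]; apply: P1; apply: QP; exists r; apply: tofrac_inj.
  by rewrite mul1r rmorphM /= -E divfK.
move=> r /IP /PQ [y E]; exists y.
by rewrite mulrAC -rmorphM /= mulrC (mulrC b) E rmorphM /= mulrC mulfK.
Qed.

(* Determinant trick: x is an eigenvalue of a matrix with entries in R. *)
Lemma stable_ideal_integral I (x : K) : dedekind_domain R -> is_ideal I ->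
  (exists2 a, I a & a != 0) ->
  (forall r, I r -> exists2 s, I s & x * r%:F = s%:F) -> in_base x.
Proof.
move=> [hN hC _] idI [a Ia a0] hx; apply: hC.
have [m [e Ie]] := hN _ idI.
have /choice[M hM] : forall i, exists c : 'I_m -> R,
    x * (e i)%:F = (\sum_j c j * e j)%:F.
  move=> i; have [s] := hx _ (span_gen i Ie).
  by rewrite {1}Ie => -[c _ <-] ->; exists c.
(* Transposed because eigenvectors are rows: the row of generators is an eigenvector for [x],
   non-zero because [I] is. *)
pose A : 'M[R]_m := \matrix_(j, i) M i j.
exists (char_poly A); first exact: char_poly_monic.
rewrite map_char_poly -eigenvalue_root_char; apply/eigenvalueP.
exists (\row_i (e i)%:F).
  apply/rowP => i; rewrite !mxE hM rmorph_sum /=; apply: eq_bigr => j _.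
  by rewrite !mxE rmorphM mulrC.
apply: contra_neqN a0 => /eqP/rowP e0; have := Ia.
rewrite Ie => -[c _ <-]; rewrite big1 // => i _.
move: (e0 i); rewrite !mxE => /eqP; rewrite tofrac_eq0 => /eqP ->.
by rewrite mulr0.
Qed.

(** Let [A] be the product of [J] with its inverse [inv]. If [A] were proper, some [x] outside [R]
    would send [A] into [R], hence [inv] into itself; then [x] would stabilise a non-zero ideal of
    [R] and be integral, a contradiction. *)
Lemma dedekind_invertible J : dedekind_domain R -> is_ideal J ->
  (exists2 a, J a & a != 0) ->
  exists m (e : 'I_m -> R) (y : 'I_m -> K),
    [/\ forall i, J (e i), forall i r, J r -> in_base (y i * r%:F)
      & \sum_i (e i)%:F * y i = 1].
Proof.
move=> hD idJ [a Ja a0]; have [hN _ _] := hD.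
have aF : a%:F != 0 :> K by rewrite tofrac_eq0.
have [m [e Je]] := hN _ idJ.
pose inv (z : K) := forall r, J r -> in_base (z * r%:F).
have invD z t : inv z -> inv t -> inv (z + t).
  by move=> hz ht r Jr; rewrite mulrDl; apply: in_baseD; [apply: hz|apply: ht].
have invZ z (r : R) : inv z -> inv (r%:F * z).
  by move=> hz s Js; rewrite -mulrA; apply: in_baseM; [exists r|apply: hz].
have inv0 : inv 0 by move=> r _; rewrite mul0r; apply: in_base0.
have inv1 : inv 1 by move=> r _; rewrite mul1r; exists r.
pose A := [set r | exists2 y : 'I_m -> K, (forall i, inv (y i)) &
                   r%:F = \sum_i (e i)%:F * y i].
have idA : is_ideal A.
  split.
  - by exists (fun=> 0) => //; rewrite big1 ?rmorph0 // => i _; rewrite mulr0.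
  - move=> r s [y hy E] [z hz F]; exists (fun i => y i + z i) => [i|].
      exact: invD.
    by rewrite rmorphD /= E F -big_split; apply: eq_bigr => i _; rewrite mulrDr.
  - move=> r s [y hy E]; exists (fun i => r%:F * y i) => [i|]; first exact: invZ.
    by rewrite rmorphM /= E mulr_sumr; apply: eq_bigr => i _; rewrite mulrCA.
have JA z r : inv z -> J r -> exists2 s, A s & z * r%:F = s%:F.
  move=> hz Jr; have [s E] := hz r Jr; exists s => //.
  have := Jr; rewrite {1}Je => -[c _ F].
  exists (fun i => (c i)%:F * z) => [i|]; first exact: invZ.
  rewrite -E -F rmorph_sum mulr_sumr; apply: eq_bigr => i _.
  by rewrite rmorphM mulrC mulrAC mulrC mulrA.
have [[y hy E1]|A1] := pselect (A 1).
  by exists m, e, y; split=> [i||]; [exact: span_gen Je | | rewrite -E1 rmorph1].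
have [|x nx hx] := proper_inv_gt hD idA A1.
  have [s As E] := JA 1 a inv1 Ja; exists s => //.
  by move: E; rewrite mul1r => /tofrac_inj <-.
case: nx.
have invx z : inv z -> inv (x * z).
  by move=> hz r Jr; have [s As E] := JA z r hz Jr; rewrite -mulrA E; apply: hx.
(* This is [a * inv], which lies in [R] because [a] is in [J]: the denominators of [inv] are
   cleared. *)
pose B := [set r | inv (r%:F / a%:F)].
apply: (@stable_ideal_integral B) => //.
- split.
  + by move=> /=; rewrite /B /= rmorph0 mul0r.
  + by move=> r s Br Bs; rewrite /B /= rmorphD mulrDl; apply: invD.
  + by move=> r s Bs; rewrite /B /= rmorphM -mulrA; apply: invZ.
- by exists a => //; rewrite /B /= divff.
move=> r Br; have [s E] := invx _ Br a Ja.
rewrite mulrA divfK // in E; exists s => //.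
by rewrite /B /= -E -mulrA; apply: invx.
Qed.

End Invertibility.

(** * Monomial orderings and leading terms *)

Section LeadingTerms.

Variables (n : nat) (R : idomainType) (le : rel 'X_{1..n}).
Hypothesis hle : monomial_ordering le.
Local Notation K := {fraction R}.
Implicit Types (p q u w : {mpoly K[n]}) (a b m : 'X_{1..n}).

Let le_refl : reflexive le. Proof. by case: hle => -[[[]]]. Qed.
Let le_trans : transitive le. Proof. by case: hle => -[[[]]]. Qed.
Let le_anti : antisymmetric le. Proof. by case: hle => -[[]]. Qed.
Let le_total : total le. Proof. by case: hle => -[]. Qed.
Let le_add a b c : le a b -> le (a + c)%MM (b + c)%MM.
Proof. by case: hle => _ _; apply. Qed.

(** If [a <= 0], adding the least exponent [z] gives [z + a <= z], so [z + a = z] and [a = 0]. *)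
Lemma monomial_ordering_le0 a : le 0%MM a.
Proof.
have [_ wo _] := hle.
have [|z [[_ lbz] _]] := wo predT; first by exists 0%MM.
have /orP[//|a0] := le_total 0%MM a.
have za : le (z + a)%MM z.
  by have := le_add z a0; rewrite add0m addmC.
have /eqP : (z + a)%MM = z by apply: le_anti; rewrite za lbz.
by rewrite -{2}[z]addm0 eqm_add2l => /eqP ->.
Qed.

Definition leading p a := p@_a != 0 /\ forall m, p@_m != 0 -> le m a.

(** Vacuous for [p = 0], so that it survives the removal of terms until none is left. *)
Definition below a p := forall m, p@_m != 0 -> le m a && (m != a).

Lemma ldeg_leading p : p != 0 -> leading p (ldeg le p).
Proof.
rewrite -msupp_eq0 => p0; rewrite /leading /ldeg.
have ss : sorted le (sort le (msupp p)) by apply: sort_sorted.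
have mem m : (m \in sort le (msupp p)) = (p@_m != 0).
  by rewrite mem_sort mcoeff_msupp.
have s0 : sort le (msupp p) != [::].
  by rewrite -size_eq0 size_sort size_eq0.
case: (sort le (msupp p)) s0 ss mem => [//|x s] _ /= ss mem.
split=> [|m]; first by rewrite -mem mem_last.
rewrite -mem; elim: s x m ss {mem} => [|y s IH] x m /=.
  by move=> _; rewrite inE => /eqP ->.
move=> /andP[xy ss]; rewrite inE => /predU1P[->|]; last exact: IH.
by apply: le_trans xy _; apply: IH => //; apply: mem_head.
Qed.

Lemma leading_uniq p a b : leading p a -> leading p b -> a = b.
Proof. by move=> [pa ha] [pb hb]; apply: le_anti; rewrite ha // hb. Qed.

Lemma leading_ldegE p a : leading p a -> ldeg le p = a.
Proof.
move=> pa; apply: leading_uniq (pa); apply: ldeg_leading.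
by apply: contraNneq pa.1 => ->; rewrite mcoeff0.
Qed.

Lemma mcoeffM_neq0 p q m : (p * q)@_m != 0 ->
  exists a b, [/\ p@_a != 0, q@_b != 0 & m = (a + b)%MM].
Proof.
rewrite -mcoeff_msupp => /msuppM_le /allpairsP[[a b] /= []].
by rewrite !mcoeff_msupp => pa qb ->; exists a, b.
Qed.

Lemma le_add2 a b c d : le a b -> le c d -> le (a + c)%MM (b + d)%MM.
Proof.
move=> ab cd; apply: le_trans (le_add c ab) _.
by rewrite ![(b + _)%MM]addmC; apply: le_add.
Qed.

(** The exponent [b + c] is squeezed between [a + c] and [b + d]; then cancel. *)
Lemma le_add_eq a b c d : le a b -> le c d -> (a + c)%MM = (b + d)%MM ->
  a = b /\ c = d.
Proof.
move=> ab cd E.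
have E1 : (a + c)%MM = (b + c)%MM.
  apply: le_anti; rewrite le_add //= E.
  by rewrite ![(b + _)%MM]addmC; apply: le_add.
move: (E1) => /eqP; rewrite eqm_add2r => /eqP ab1; split=> //.
by move: E => /eqP; rewrite ab1 eqm_add2l => /eqP.
Qed.

(** By [le_add_eq], only the two top exponents can add up to their sum, and [g - 'X_[b]] no longer
    has the exponent [b]. *)
Lemma mcoeffM_leading u g b : (forall m, g@_m != 0 -> le m b) -> g@_b = 1 ->
  (forall m, u@_m != 0 -> le m (ldeg le u)) ->
  (u * g)@_(ldeg le u + b)%MM = lc le u.
Proof.
move=> gle gb ule.
have -> : g = 'X_[b] + (g - 'X_[b]) by rewrite addrC subrK.
rewrite mulrDr mcoeffD addmC mcoeffMX -[RHS]addr0; congr (_ + _).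
apply/eqP/negbNE/negP => /mcoeffM_neq0[m1 [m2 [um1]]].
rewrite mcoeffB mcoeffX; have [<-|bm2] := eqVneq b m2.
  by rewrite gb subrr eqxx.
rewrite subr0 => gm2; rewrite addmC => E.
have [_ E2] := le_add_eq (ule _ um1) (gle _ gm2) (esym E).
by rewrite E2 eqxx in bm2.
Qed.

(** The bound on [w] is not strict, so [w * f] might reach the top exponent of [u * g]. Disjointness
    of the supports of [a] and [b] excludes this: [a] would divide the leading exponent of [u],
    which is strictly below [a]. *)
Lemma leading_comb u w f g a b :
  (forall i, a i = 0%N \/ b i = 0%N) ->
  (forall m, f@_m != 0 -> le m a) ->
  (forall m, g@_m != 0 -> le m b) -> g@_b = 1 ->
  u != 0 -> below a u ->
  (forall m, w@_m != 0 -> le (m + a)%MM (ldeg le u + b)%MM) ->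
  ldeg le (u * g + w * f) = (ldeg le u + b)%MM /\
  lc le (u * g + w * f) = lc le u.
Proof.
move=> ab fa gb gb1 u0 ua wb.
have [ud ule] := ldeg_leading u0.
have lcE : (u * g + w * f)@_(ldeg le u + b)%MM = lc le u.
  rewrite mcoeffD mcoeffM_leading // -[RHS]addr0; congr (_ + _).
  apply/eqP/negbNE/negP => /mcoeffM_neq0[m1 [m2 [wm1 fm2 E]]].
  have E1 : (ldeg le u + b)%MM = (m1 + a)%MM.
    apply: le_anti; rewrite wb // andbT E.
    by apply: le_add2; [exact: le_refl|exact: fa].
  (* Where [a i] is non-zero, [b i] vanishes and [E1] reads [ldeg le u i = m1 i + a i]. *)
  have /mnm_lepP adu : forall i, (a i <= ldeg le u i)%N.
    move=> i; have [->//|bi] := ab i.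
    by move/mnmP/(_ i): E1; rewrite !mnmDE bi addn0 => ->; apply: leq_addl.
  (* A multiple of [a] is at least [a] in the ordering, since every exponent is at least [0]. *)
  have := ua _ ud; rewrite -{1 2}(submK adu) => /andP[dua].
  have := le_add a (monomial_ordering_le0 (ldeg le u - a)%MM).
  rewrite add0m => adu'.
  by case/eqP; apply: le_anti; rewrite dua.
have ld : leading (u * g + w * f) (ldeg le u + b)%MM.
  split=> [|m]; first by rewrite lcE.
  rewrite mcoeffD => h.
  have [e|/mcoeffM_neq0[m1 [m2 [um1 gm2 ->]]]] := eqVneq (u * g)@_m 0; last first.
    by apply: le_add2; [apply: ule|apply: gb].
  move: h; rewrite e add0r => /mcoeffM_neq0[m1 [m2 [wm1 fm2 ->]]].
  by apply: le_trans (wb _ wm1); apply: le_add2; [exact: le_refl|exact: fa].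
by rewrite /lc (leading_ldegE ld).
Qed.

End LeadingTerms.

(** * Ideals inside the fraction field *)

Section Ideals.

Variable R : idomainType.
Local Notation K := {fraction R}.
Implicit Types (A B D F G : set K).

(** Turns a coefficient for a reduction by the monic multiple of [g] into one for [g] itself. *)
Lemma scale_ideal_mul a F G (c : K) : a != 0 ->
  mul_ideal (scale_ideal a F) G c -> mul_ideal F G (c / a).
Proof.
move=> a0 [m [x [y [Fx Gy ->]]]].
exists m, (fun i => x i / a), y; split=> [i||] //.
  by case: (Fx i) => z Fz <-; rewrite mulrC mulKf.
by rewrite mulr_suml; apply: eq_bigr => i _; rewrite mulrAC.
Qed.

Lemma fractional_idealP F : is_fractional_ideal F ->
  [/\ F 0, forall x y, F x -> F y -> F (x + y) & forall r x, F x -> F (r%:F * x)].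
Proof.
move=> [_ [m [e ->]]]; split.
- by exists (fun=> 0) => //; rewrite big1 // => i _; rewrite rmorph0 mul0r.
- move=> _ _ [c _ <-] [d _ <-]; exists (fun i => c i + d i) => //.
  by rewrite -big_split; apply: eq_bigr => i _; rewrite rmorphD mulrDl.
- move=> r _ [c _ <-]; exists (fun i => r * c i) => //.
  by rewrite mulr_sumr; apply: eq_bigr => i _; rewrite rmorphM mulrA.
Qed.

Lemma fractional_ideal_integral D : noetherian R ->
  D `<=` @in_base R -> is_ideal [set r : R | D r%:F] ->
  (exists2 x, D x & x != 0) -> is_fractional_ideal D.
Proof.
move=> hN Dint idD D0; split=> //.
have [m [e De]] := hN _ idD; exists m, (fun i => (e i)%:F).
apply/seteqP; split=> [z Dz|_ [c _ <-]].
  have [r E] := Dint z Dz; have : D r%:F by rewrite -E.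
  rewrite -/([set r : R | D r%:F] r) De => -[c _ F].
  exists c => //; rewrite E -F rmorph_sum.
  by apply: eq_bigr => i _; rewrite rmorphM.
have : [set r : R | D r%:F] (\sum_i c i * e i).
  apply: is_ideal_sum => // i; have [_ _ DM] := idD.
  by apply: DM; apply: span_gen De.
by rewrite /= rmorph_sum; congr D; apply: eq_bigr => i _; rewrite rmorphM.
Qed.

(* The inverse of A is contained in B * (A :&: B)^-1. *)
Lemma coprime_inv_sub A B (i j c : K) : dedekind_domain R ->
  B `<=` @in_base R -> is_ideal [set r : R | B r%:F] ->
  (exists2 x, B x & x != 0) ->
  A i -> B j -> i + j = 1 -> (forall z, A z -> in_base (c * z)) ->
  mul_ideal B (inv_ideal (A `&` B)) c.
Proof.
move=> hD Bint idB [x Bx x0] Ai Bj ij1 hc.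
have [|m [e [y [Be hy E]]]] := dedekind_invertible hD idB.
  have [r Er] := Bint x Bx; exists r; first by rewrite /= -Er.
  by rewrite -tofrac_eq0 -Er.
exists m, (fun k => (e k)%:F), (fun k => c * y k); split=> //; last first.
  by under eq_bigr do rewrite mulrCA; rewrite -mulr_sumr E mulr1.
move=> k z [Az Bz]; have hyB t : B t -> in_base (y k * t).
  by move=> Bt; have [r Er] := Bint t Bt; rewrite Er; apply: hy; rewrite /= -Er.
(* All four factors are in [R]: [c] sends [i] and [z] of [A] into [R], and [y k] does so for [z] and
   [j] of [B]. *)
have -> : c * y k * z = (c * i) * (y k * z) + (c * z) * (y k * j).
  by rewrite -[LHS]mulr1 -ij1; ring.
by apply: in_baseD; apply: in_baseM; [exact: hc|exact: hyB|exact: hc|exact: hyB].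
Qed.

End Ideals.

(** * Polynomials with coefficients in [R], and coprime monomials *)

Section Polynomials.

Variables (n : nat) (R : idomainType).
Local Notation K := {fraction R}.
Implicit Types (p q : {mpoly K[n]}).

Definition mpoly_in_base p := forall m, in_base p@_m.

Lemma mpoly_in_baseP p :
  mpoly_in_base p <-> exists h : {mpoly R[n]}, p = map_mpoly (@tofrac R) h.
Proof.
split=> [|[h ->] m]; last by exists h@_m; rewrite mcoeff_map_mpoly.
move=> /choice[c hc]; exists (\sum_(m <- msupp p) c m *: 'X_[m]).
rewrite {1}[p]mpolyE raddf_sum; apply: eq_bigr => m _.
by rewrite /= map_mpolyZ map_mpolyX hc.
Qed.

Lemma mpoly_in_baseD p q :
  mpoly_in_base p -> mpoly_in_base q -> mpoly_in_base (p + q).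
Proof. by move=> hp hq m; rewrite mcoeffD; apply: in_baseD. Qed.

Lemma mpoly_in_baseM p q :
  mpoly_in_base p -> mpoly_in_base q -> mpoly_in_base (p * q).
Proof.
move=> hp hq m; rewrite mcoeffM; apply: big_ind => [||k _].
- exact: in_base0.
- exact: in_baseD.
- exact: in_baseM.
Qed.

Lemma mpoly_in_base_scale_rem (c : K) p a :
  mpoly_in_base (c *: p) -> mpoly_in_base (c *: (p - p@_a *: 'X_[a])).
Proof.
move=> h m; have := h m; rewrite !mcoeffZ mcoeffB mcoeffZ mcoeffX.
have [<-|_] := eqVneq a m; last by rewrite mulr0 subr0.
by rewrite mulr1 subrr mulr0 => _; apply: in_base0.
Qed.

(** A variable in both supports would be a common divisor; evaluation at the origin shows that it is
    not a unit. *)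
Lemma coprime_mpolyX (a b : 'X_{1..n}) :
  coprime_mpoly ('X_[a] : {mpoly K[n]}) 'X_[b] ->
  forall i, a i = 0%N \/ b i = 0%N.
Proof.
move=> hab i; have [->|ai] := eqVneq (a i) 0%N; first by left.
have [->|bi] := eqVneq (b i) 0%N; first by right.
have dvd (c : 'X_{1..n}) : c i != 0%N ->
    exists u : {mpoly K[n]}, 'X_[c] = u * 'X_i.
  move=> ci; exists 'X_[c - U_(i)]; rewrite -mpolyXD submK //.
  apply/mnm_lepP => j; rewrite mnm1E; have [<-|//] := eqVneq i j.
  by rewrite lt0n.
have /divrr/(congr1 (meval (fun=> 0 : K))) := hab _ (dvd _ ai) (dvd _ bi).
by rewrite mevalM mevalXU mul0r meval1 => /eqP; rewrite eq_sym oner_eq0.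
Qed.

End Polynomials.

(** * Reduction of the combinations of the two polynomials *)

Section Reduction.

Variables (n : nat) (R : idomainType) (le : rel 'X_{1..n}).
Hypothesis hle : monomial_ordering le.
Local Notation K := {fraction R}.
Implicit Types (f g u w : {mpoly K[n]}) (F G : set K).

Definition monicize f := (lc le f)^-1 *: f.

(** Meant for [c] in both ideals, [i] in the first and [j] in the second: each of the four scaled
    factors is then integral, whereas [c] alone cannot serve both [f] and [g]. *)
Lemma scale_mulE (i j c : K) f g : i + j = 1 ->
  c *: (f * g) = (i *: f) * (c *: g) + (c *: f) * (j *: g).
Proof.
move=> ij1; rewrite -!scalerAl -!scalerAr !scalerA -scalerDl (mulrC i) -mulrDr.
by rewrite ij1 mulr1.
Qed.

Lemma lc_neq0 f : f != 0 -> lc le f != 0.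
Proof. by move=> f0; have [] := ldeg_leading hle f0. Qed.

Lemma monic_le f m : f != 0 -> (monicize f)@_m != 0 -> le m (ldeg le f).
Proof.
move=> f0; rewrite mcoeffZ mulf_eq0 => /norP[_].
by have [_] := ldeg_leading hle f0; apply.
Qed.

Lemma monic_coef f : f != 0 -> (monicize f)@_(ldeg le f) = 1.
Proof. by move=> f0; rewrite mcoeffZ mulVf // lc_neq0. Qed.

Lemma monic_below f : f != 0 -> below le (ldeg le f) (monicize f - 'X_[ldeg le f]).
Proof.
move=> f0 m; rewrite mcoeffB mcoeffX; have [<-|ne] := eqVneq (ldeg le f) m.
  by rewrite monic_coef // subrr eqxx.
by rewrite subr0 => /(monic_le f0) ->.
Qed.

(** For [f != 0], this ideal attached to [monicize f] spans the same module as [F] attached to [f];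
    it is [lc_ideal] seen inside the fraction field. *)
Definition monic_ideal f F := scale_ideal (lc le f) F.

Lemma monic_int f F c : nonzero_ppoly (f, F) -> monic_ideal f F c ->
  mpoly_in_base (c *: monicize f).
Proof.
move=> [[/= _ hF] f0] [d Fd <-]; apply/mpoly_in_baseP.
by rewrite scalerA mulrAC mulfV ?lc_neq0 // mul1r; apply: hF.
Qed.

Lemma monic_ideal_int f F : nonzero_ppoly (f, F) ->
  monic_ideal f F `<=` @in_base R.
Proof.
move=> hf c /(monic_int hf)/(_ (ldeg le f)).
by rewrite mcoeffZ monic_coef ?mulr1 //; case: hf.
Qed.

Lemma monic_ideal_ideal f F : nonzero_ppoly (f, F) ->
  is_ideal [set r : R | monic_ideal f F r%:F].
Proof.
move=> [[/= /fractional_idealP[F0 FD FM] _] _]; split.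
- by exists 0; rewrite ?mulr0 ?rmorph0.
- move=> x y [s Fs Es] [t Ft Et]; exists (s + t); first exact: FD.
  by rewrite mulrDr Es Et rmorphD.
- move=> r x [s Fs Es]; exists (r%:F * s); first exact: FM.
  by rewrite mulrCA Es rmorphM.
Qed.

Lemma monic_ideal_neq0 f F : nonzero_ppoly (f, F) ->
  exists2 x, monic_ideal f F x & x != 0.
Proof.
move=> [[/= [[x Fx x0] _] _] f0]; exists (lc le f * x); first by exists x.
by rewrite mulf_neq0 // lc_neq0.
Qed.

Lemma one_step_reduction1 k (Gs : k.-tuple (ppoly n R)) (p : ppoly n R)
    (i0 : 'I_k) (c : K) :
  nonzero_ppoly p -> (forall i, nonzero_ppoly (tnth Gs i)) ->
  (ldeg le (tnth Gs i0).1 <= ldeg le p.1)%MM ->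
  mul_ideal (tnth Gs i0).2 (inv_ideal p.2) c ->
  lc le p.1 = c * lc le (tnth Gs i0).1 ->
  one_step_reduction le Gs p
    (p.1 - c *: ('X_[(ldeg le p.1 - ldeg le (tnth Gs i0).1)%MM]
                   * (tnth Gs i0).1), p.2).
Proof.
move=> hp hGs hdeg hc hlc; split=> //.
exists (fun i => if i == i0 then c else 0); split.
- move=> i _; case: eqP => [->//|_].
  (* Zero belongs to the product of ideals as the empty sum. *)
  exists 0%N, (fun=> 0), (fun=> 0); split=> [[]//|[]//|].
  by rewrite big_ord0.
- rewrite (bigD1 i0) //= eqxx big1 ?addr0 // => i /andP[_ /negPf ->].
  by rewrite mul0r.
- rewrite (bigD1 i0) //= eqxx big1 ?addr0 // => i /andP[_ /negPf ->].
  by rewrite scale0r.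
Qed.

(** By [leading_comb] the leading term comes from [u * monicize g], so one reduction by [g] deletes
    the leading term of [u] and leaves [w] alone. The tuple and the index are arbitrary because [f]
    and [g] will also exchange roles. *)
Lemma reduction_step k (Gs : k.-tuple (ppoly n R)) (i0 : 'I_k) f g F G
    (i j : K) u w (D := monic_ideal f F `&` monic_ideal g G) :
  dedekind_domain R -> (forall i, nonzero_ppoly (tnth Gs i)) ->
  tnth Gs i0 = (g, G) -> nonzero_ppoly (f, F) ->
  (forall i, ldeg le f i = 0%N \/ ldeg le g i = 0%N) ->
  monic_ideal f F i -> monic_ideal g G j -> i + j = 1 ->
  u != 0 -> below le (ldeg le f) u ->
  (forall c, monic_ideal f F c -> mpoly_in_base (c *: u)) ->
  (forall c, monic_ideal g G c -> mpoly_in_base (c *: w)) ->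
  (forall m, w@_m != 0 -> le (m + ldeg le f)%MM (ldeg le u + ldeg le g)%MM) ->
  one_step_reduction le Gs (u * monicize g + w * monicize f, D)
    ((u - lc le u *: 'X_[ldeg le u]) * monicize g + w * monicize f, D).
Proof.
move=> hD hGs E0 hf cop Ai Bj ij1 u0 ua uint wint wb.
have hg : nonzero_ppoly (g, G) by rewrite -E0.
have [f0 g0] : f != 0 /\ g != 0 by case: hf; case: hg.
set h := u * monicize g + w * monicize f.
have [hdeg hlc] : ldeg le h = (ldeg le u + ldeg le g)%MM /\ lc le h = lc le u.
  apply: (@leading_comb _ _ _ hle _ _ _ _ (ldeg le f)) => //.
  - by move=> m; apply: monic_le.
  - by move=> m; apply: monic_le.
  - exact: monic_coef.
have lu0 := lc_neq0 u0.
have lg0 := lc_neq0 g0.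
have h0 : h != 0.
  by apply: contraNneq lu0 => e; rewrite -hlc e /lc mcoeff0.
have [hN _ _] := hD.
have hDfrac : is_fractional_ideal D.
  have [_ AD AM] := monic_ideal_ideal hf.
  have [_ BD BM] := monic_ideal_ideal hg.
  apply: fractional_ideal_integral => //.
  - by move=> z [/(monic_ideal_int hf)].
  - have [A0 _ _] := monic_ideal_ideal hf; have [B0 _ _] := monic_ideal_ideal hg.
    split; first by split.
      by move=> x y [Ax Bx] [Ay By]; split; [apply: AD|apply: BD].
    by move=> r x [Ax Bx]; split; [apply: AM|apply: BM].
  (* Both ideals are integral, so the product of non-zero elements of each lies in their
     intersection. *)
  have [x Ax x0] := monic_ideal_neq0 hf; have [y By y0] := monic_ideal_neq0 hg.
  have [r Er] := monic_ideal_int hf Ax; have [s Es] := monic_ideal_int hg By.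
  exists (x * y); last by rewrite mulf_neq0.
  rewrite Er Es -rmorphM; split.
    by rewrite mulrC; apply: AM; rewrite /= -Er.
  by apply: BM; rewrite /= -Es.
have hnz : nonzero_ppoly (h, D).
  split=> //; split=> // c [Ac Bc]; apply/mpoly_in_baseP => /=.
  rewrite scalerDr; apply: mpoly_in_baseD.
    rewrite (scale_mulE _ _ _ ij1).
    by apply: mpoly_in_baseD; apply: mpoly_in_baseM;
      [exact: uint|exact: monic_int hg _|exact: uint|exact: monic_int hg _].
  rewrite (scale_mulE _ _ _ (etrans (addrC j i) ij1)).
  by apply: mpoly_in_baseD; apply: mpoly_in_baseM;
    [exact: wint|exact: monic_int hf _|exact: wint|exact: monic_int hf _].
have -> : (u - lc le u *: 'X_[ldeg le u]) * monicize g + w * monicize f =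
    h - (lc le u / lc le g) *: ('X_[ldeg le h - ldeg le (tnth Gs i0).1] *
                                (tnth Gs i0).1).
  rewrite E0 /= hdeg addmK mulrBl /h [RHS]addrAC; congr (_ - _ + _).
  by rewrite /monicize -scalerAl -scalerAr scalerA.
apply: (@one_step_reduction1 _ Gs (h, D)) => //; rewrite ?E0 /=.
- by rewrite hdeg; apply/mnm_lepP => l; rewrite mnmDE leq_addl.
(* The coefficient [lc le u] sends the first ideal into [R], so [coprime_inv_sub] applies to it. *)
- apply: scale_ideal_mul => //.
  apply: (coprime_inv_sub (i := i) (j := j)) => //.
  + exact: monic_ideal_int hg.
  + exact: monic_ideal_ideal.
  + exact: monic_ideal_neq0.
  + by move=> z Az; have := uint z Az (ldeg le u); rewrite mcoeffZ mulrC.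
- by rewrite hlc divfK.
Qed.

Lemma below_rem a u m : below le a u -> below le a (u - u@_m *: 'X_[m]).
Proof.
move=> ua m'; rewrite mcoeffB mcoeffZ mcoeffX; have [<-|_] := eqVneq m m'.
  by rewrite mulr1 subrr eqxx.
by rewrite mulr0 subr0; apply: ua.
Qed.

Lemma size_msupp_rem u : u != 0 ->
  (size (msupp (u - lc le u *: 'X_[ldeg le u])) < size (msupp u))%N.
Proof.
move=> u0; have [ul _] := ldeg_leading hle u0.
rewrite /lc (perm_size (msupp_rem u (ldeg le u))) size_rem ?mcoeff_msupp //.
by rewrite prednK // lt0n size_eq0 msupp_eq0.
Qed.

(** Induction on the total number of terms of [u] and [w]: each step removes one term and preserves
    all the other conditions. *)
Lemma comb_reduces_to_zero f g F G (i j : K) u w :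
  dedekind_domain R -> nonzero_ppoly (f, F) -> nonzero_ppoly (g, G) ->
  (forall i, ldeg le f i = 0%N \/ ldeg le g i = 0%N) ->
  monic_ideal f F i -> monic_ideal g G j -> i + j = 1 ->
  below le (ldeg le f) u -> below le (ldeg le g) w ->
  (forall c, monic_ideal f F c -> mpoly_in_base (c *: u)) ->
  (forall c, monic_ideal g G c -> mpoly_in_base (c *: w)) ->
  reduces_to_zero le [tuple (f, F); (g, G)]
    (u * monicize g + w * monicize f, monic_ideal f F `&` monic_ideal g G).
Proof.
move=> hD hf hg cop Ai Bj ij1.
have [N] := ubnP (size (msupp u) + size (msupp w)).
elim: N u w => // N IH u w; rewrite ltnS => sN ua wb uint wint.
have hGs : forall i, nonzero_ppoly (tnth [tuple (f, F); (g, G)] i).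
  by move=> [[|[|//]]] ?.
have stepu : u != 0 -> (forall m, w@_m != 0 ->
    le (m + ldeg le f)%MM (ldeg le u + ldeg le g)%MM) ->
    reduces_to_zero le [tuple (f, F); (g, G)]
      (u * monicize g + w * monicize f, monic_ideal f F `&` monic_ideal g G).
  move=> u0 hw; apply: rt_trans; first apply: rt_step.
    (* The index [lift ord0 ord0] is that of [(g, G)]. *)
    by apply: (@reduction_step _ _ (lift ord0 ord0) f g F G i j).
  apply: IH => //.
  - by apply: leq_trans sN; rewrite ltn_add2r size_msupp_rem.
  - exact: below_rem.
  - by move=> c Ac; apply: mpoly_in_base_scale_rem; apply: uint.
have stepw : w != 0 -> (forall m, u@_m != 0 ->
    le (m + ldeg le g)%MM (ldeg le w + ldeg le f)%MM) ->
    reduces_to_zero le [tuple (f, F); (g, G)]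
      (u * monicize g + w * monicize f, monic_ideal f F `&` monic_ideal g G).
  move=> w0 hu; apply: rt_trans; first apply: rt_step.
    rewrite addrC setIC; apply: (@reduction_step _ _ ord0 g f G F j i) => //.
    - by move=> l; case: (cop l); [right|left].
    - by rewrite addrC.
  rewrite addrC setIC; apply: IH => //.
  - by apply: leq_trans sN; rewrite ltn_add2l size_msupp_rem.
  - exact: below_rem.
  - by move=> c Bc; apply: mpoly_in_base_scale_rem; apply: wint.
have [u0|u0] := eqVneq u 0.
  have [w0|w0] := eqVneq w 0.
    by rewrite u0 w0 !mul0r addr0; apply: rt_refl.
  by apply: stepw => // m; rewrite u0 mcoeff0 eqxx.
have [w0|w0] := eqVneq w 0.
  by apply: stepu => // m; rewrite w0 mcoeff0 eqxx.
have [[_ ule] [_ wle]] := (ldeg_leading hle u0, ldeg_leading hle w0).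
have [[[[_ tr] _] tot] _ add] := hle.
(* The product with the larger top exponent is the one to reduce; a tie may go either way, the bound
   in [reduction_step] being weak. *)
have /orP[h|h] := tot (ldeg le u + ldeg le g)%MM (ldeg le w + ldeg le f)%MM.
  by apply: stepw => // m /ule um; apply: tr h; apply: add.
by apply: stepu => // m /wle wm; apply: tr h; apply: add.
Qed.

End Reduction.

Theorem theorem4p9 (R : idomainType) (hR : dedekind_domain R) (n : nat)
    (le : rel 'X_{1..n}) (hle : monomial_ordering le)
    (f g : {mpoly {fraction R}[n]}) (F G : set {fraction R})
    (hf : nonzero_ppoly (f, F)) (hg : nonzero_ppoly (g, G))
    (hlm : coprime_mpoly (lm le f) (lm le g))
    (hlc : coprime_ideals (lc_ideal le (f, F)) (lc_ideal le (g, G))) :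
  reduces_to_zero le [tuple (f, F); (g, G)] (spoly le (f, F) (g, G)).
Proof.
have cop := coprime_mpolyX hlm.
have [f0 g0] : f != 0 /\ g != 0 by case: hf; case: hg.
have : [set: R] 1 by [].
rewrite -hlc => -[i Ai [j Bj ij1]].
pose a := ldeg le f; pose b := ldeg le g.
(* The supports are disjoint, so the lcm is the product. *)
have mE : mlcm a b = (a + b)%MM.
  apply/mnmP => l; rewrite /mlcm !mnmE.
  by case: (cop l) => ->; rewrite ?max0n ?maxn0 ?addn0.
(* The S-polynomial is ['X_[b] * monicize le f - 'X_[a] * monicize le g]; add and subtract the
   product of the two monic polynomials. *)
have -> : spoly le (f, F) (g, G) =
    ((monicize le f - 'X_[a]) * monicize le g + ('X_[b] - monicize le g) * monicize le f,
     monic_ideal le f F `&` monic_ideal le g G).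
  rewrite /spoly /= -/a -/b mE addmK [(a + b)%MM]addmC addmK.
  by congr (_, _); rewrite !scalerAr -/(monicize _ _); ring.
have below_opp : below le b ('X_[b] - monicize le g).
  by move=> m; rewrite -opprB mcoeffN oppr_eq0; apply: monic_below.
have rem h H c : nonzero_ppoly (h, H) -> monic_ideal le h H c ->
    mpoly_in_base (c *: (monicize le h - 'X_[ldeg le h])).
  move=> hh Hc; have h0 : h != 0 by case: hh.
  (* Subtracting the leading monomial only deletes a term, whose coefficient is [1]. *)
  have := mpoly_in_base_scale_rem (ldeg le h) (monic_int hle hh Hc).
  by rewrite monic_coef // scale1r.
apply: (@comb_reduces_to_zero _ _ _ hle _ _ _ _ i%:F j%:F) => //.
- by rewrite -rmorphD ij1 rmorph1.
- exact: monic_below.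
- by move=> c; apply: rem.
- move=> c Bc; rewrite -opprB scalerN => m; rewrite mcoeffN -mulN1r.
  by apply: in_baseM; [exists (-1); rewrite rmorphN1|apply: rem Bc _].
Qed.
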